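(* Let $G$ be a finite group and $U:g\mapsto U_g$ a unitary representation of $G$ on $\mathcal{H}_d=\mathbb{C}^d$. Then there exists a positive integer $r$, depending only on the group $G$ and the representation $U$ (and in particular not on $m$), such that for every positive integer $m$ the state of $m$ qudits can be transmitted perfectly using $m+r$ qudits subject to the collective noise described by $U$; that is, there exist completely positive trace-preserving maps $\mathcal{C}:\mathcal{B}(\mathcal{H}_d^{\otimes m})\to\mathcal{B}(\mathcal{H}_d^{\otimes(m+r)})$ and $\mathcal{D}:\mathcal{B}(\mathcal{H}_d^{\otimes(m+r)})\to\mathcal{B}(\mathcal{H}_d^{\otimes m})$ such that $\mathcal{D}\circ\mathcal{E}_p\circ\mathcal{C}=\mathrm{id}$ for every probability distribution $p$ on $G$. Consequently the transmission rate $m/(m+r)$ tends to $1$ as $m\to\infty$.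
   Context: For a probability distribution $p=(p_g)_{g\in G}$ on $G$, the collective noise channel on $N$ qudits is $\mathcal{E}_p(\rho)=\sum_{g\in G}p_g\,U_g^{\otimes N}\rho\,(U_g^{\otimes N})^\dagger$, for $\rho\in\mathcal{B}(\mathcal{H}_d^{\otimes N})$; in the claim $N=m+r$. A qudit is a system with Hilbert space $\mathbb{C}^d$, and $\mathcal{B}(\mathcal{H})$ denotes the linear operators on $\mathcal{H}$. *)

(* Defs.v *)
(* Operators on C^n are complex matrices 'M[R[i]]_n acting on column vectors.
   The Hilbert space of N qudits is C^(d^N), with U^{(x)N} given by the iterated
   Kronecker product [ntensmx]. *)
From mathcomp Require Import all_boot all_order all_algebra all_fingroup.
From mathcomp Require Import mxrepresentation.
From mathcomp Require Import classical_sets reals.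
From mathcomp Require Import complex mxtens.

Set Implicit Arguments.
Unset Strict Implicit.
Unset Printing Implicit Defensive.

Import Order.TTheory GRing.Theory Num.Theory.
Local Open Scope ring_scope.
Local Open Scope complex_scope.
Local Open Scope sesquilinear_scope.

Definition unitary_repr (R : realType) (gT : finGroupType) (G : {group gT})
    (d : nat) (U : mx_representation R[i] G d) : Prop :=
  forall g, g \in G -> U g \is unitarymx.

Definition is_distr (R : realType) (gT : finGroupType) (G : {group gT})
    (p : gT -> R) : Prop :=
  (forall g, g \in G -> 0 <= p g) /\ \sum_(g in G) p g = 1.

Definition collective_noise (R : realType) (gT : finGroupType) (G : {group gT})
    (d : nat) (U : mx_representation R[i] G d) (p : gT -> R) (N : nat)
    (rho : 'M[R[i]]_(d ^ N)) : 'M[R[i]]_(d ^ N) :=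
  \sum_(g in G) (p g)%:C *: (ntensmx (U g) N *m rho *m (ntensmx (U g) N)^t* ).

(* [0 <= z] in R[i] means that z is real and nonnegative, so over C this
   condition already forces A to be Hermitian. *)
Definition psdmx (R : realType) (n : nat) (A : 'M[R[i]]_n) : Prop :=
  forall v : 'cV[R[i]]_n, 0 <= (v^t* *m A *m v) 0 0.

Definition positive_map (R : realType) (a b : nat)
    (Phi : 'M[R[i]]_a -> 'M[R[i]]_b) : Prop :=
  forall A, psdmx A -> psdmx (Phi A).

(* The k x k family of a x a blocks of X : B(C^k (x) C^a). *)
Definition tens_block (R : realType) (k a : nat) (X : 'M[R[i]]_(k * a))
    (i j : 'I_k) : 'M[R[i]]_a :=
  \matrix_(x, y) X (mxtens_index (i, x)) (mxtens_index (j, y)).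

(* The map id_k (x) Phi : B(C^k (x) C^a) -> B(C^k (x) C^b). *)
Definition ampliation (R : realType) (a b k : nat)
    (Phi : 'M[R[i]]_a -> 'M[R[i]]_b) (X : 'M[R[i]]_(k * a)) :
    'M[R[i]]_(k * b) :=
  \sum_(i < k) \sum_(j < k) tensmx (delta_mx i j) (Phi (tens_block X i j)).

(* The defining property of id_k (x) Phi on elementary tensors. *)
Lemma ampliation_tens (R : realType) (a b k : nat)
    (Phi : {linear 'M[R[i]]_a -> 'M[R[i]]_b})
    (S : 'M[R[i]]_k) (A : 'M[R[i]]_a) :
  ampliation Phi (tensmx S A) = tensmx S (Phi A).
Proof.
have blk i j : tens_block (tensmx S A) i j = S i j *: A.
  by apply/matrixP => x y; rewrite !mxE !mxtens_indexK.
rewrite /ampliation; apply/matrixP => u v.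
case: (mxtens_indexP u) => u1 u2; case: (mxtens_indexP v) => v1 v2.
rewrite summxE (bigD1 u1) //= [X in _ + X]big1 ?addr0 => [|i /negPf ne]; last first.
  rewrite summxE big1 // => j _.
  by rewrite tensmxE mxE eq_sym ne /= mul0r.
rewrite summxE (bigD1 v1) //= [X in _ + X]big1 ?addr0 => [|j /negPf ne]; last first.
  by rewrite tensmxE mxE (eq_sym v1) ne andbF mul0r.
by rewrite !tensmxE blk linearZ !mxE !eqxx mul1r.
Qed.

Definition completely_positive (R : realType) (a b : nat)
    (Phi : 'M[R[i]]_a -> 'M[R[i]]_b) : Prop :=
  forall k : nat, positive_map (@ampliation R a b k Phi).

Definition trace_preserving (R : realType) (a b : nat)
    (Phi : 'M[R[i]]_a -> 'M[R[i]]_b) : Prop :=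
  forall A, \tr (Phi A) = \tr A.

Definition cptp (R : realType) (a b : nat)
    (Phi : {linear 'M[R[i]]_a -> 'M[R[i]]_b}) : Prop :=
  completely_positive Phi /\ trace_preserving Phi.

(* Main.v *)
(* A vector e of (C^d)^(x)r whose images under the U_g^(x)r are pairwise
   orthogonal for g in distinct cosets of the subgroup of scalar U_g is a
   reference token: encode rho as rho (x) e e^*, and decode by reading off the
   coset of g from the token and undoing U_g^(x)m.  Since U_g^(x)r is a
   representation, it suffices that <e, U_g^(x)r e> = 0 for every nonscalar U_g.
   These overlaps multiply under tensor products, so each g can be treated
   separately: if v, w are orthonormal eigenvectors of U_g for distinct
   eigenvalues a, b and n is the order of g, then the overlap of
   sum_(j < n) v^(x)(n-1-j) (x) w^(x)j is (a^n - b^n) / (a - b) = 0. *)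
Require Import Defs.
From HB Require Import structures.
From mathcomp Require Import all_boot all_order all_algebra all_fingroup.
From mathcomp Require Import mxrepresentation.
From mathcomp Require Import classical_sets reals topology normedtype.
From mathcomp Require Import complex mxtens.
From mathcomp Require Import boolp sequences.

Set Implicit Arguments.
Unset Strict Implicit.
Unset Printing Implicit Defensive.

Import Order.TTheory GRing.Theory Num.Theory.
Import numFieldNormedType.Exports.
Local Open Scope ring_scope.
Local Open Scope classical_set_scope.
Local Open Scope sesquilinear_scope.

(** * Adjoints of complex matrices *)

Section Adjoint.
Variable C : numClosedFieldType.

Lemma adjmxM m n p (A : 'M[C]_(m, n)) (B : 'M_(n, p)) :
  (A *m B)^t* = B^t* *m A^t*.
Proof. by rewrite trmx_mul map_mxM. Qed.

Lemma adjmxD m n (A B : 'M[C]_(m, n)) : (A + B)^t* = A^t* + B^t*.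
Proof. by rewrite linearD /= map_mxD. Qed.

Lemma adjmxZ m n c (A : 'M[C]_(m, n)) : (c *: A)^t* = c^* *: A^t*.
Proof. by rewrite linearZ /= map_mxZ. Qed.

Lemma adjmx_sum m n (I : finType) (P : pred I) (F : I -> 'M[C]_(m, n)) :
  (\sum_(i | P i) F i)^t* = \sum_(i | P i) (F i)^t*.
Proof. by rewrite linear_sum /= map_mx_sum. Qed.

Lemma adjmx1 n : (1%:M : 'M[C]_n)^t* = 1%:M.
Proof. by rewrite trmx1 map_mx1. Qed.

Lemma adjmx_tens m n p q (A : 'M[C]_(m, n)) (B : 'M_(p, q)) :
  (A *t B)^t* = A^t* *t B^t*.
Proof. by rewrite trmx_tens map_mxT. Qed.

Lemma adjmx_delta m n i j : (delta_mx i j : 'M[C]_(m, n))^t* = delta_mx j i.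
Proof. by rewrite trmx_delta map_delta_mx. Qed.

End Adjoint.

(** * Tensor products and tensor powers of matrices *)

Section Tensor.
Variable R : comPzRingType.

Lemma tensmxDr m n p q (A : 'M[R]_(m, n)) (B D : 'M_(p, q)) :
  A *t (B + D) = A *t B + A *t D.
Proof. by apply/matrixP=> i j; rewrite !mxE mulrDr. Qed.

Lemma tensmxZr m n p q c (A : 'M[R]_(m, n)) (B : 'M_(p, q)) :
  A *t (c *: B) = c *: (A *t B).
Proof. by apply/matrixP=> i j; rewrite !mxE mulrCA. Qed.

Lemma tensmx_sumr m n p q (I : finType) (A : 'M[R]_(m, n))
    (F : I -> 'M_(p, q)) :
  A *t (\sum_i F i) = \sum_i A *t F i.
Proof. exact: (big_morph _ (tensmxDr A) (tensmx0 A)). Qed.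

Lemma tens_scalar_scalar m n (c e : R) :
  (c%:M : 'M[R]_m) *t (e%:M : 'M[R]_n) = (c * e)%:M.
Proof.
apply/matrixP=> i j; case: (mxtens_indexP i) => i1 i2.
case: (mxtens_indexP j) => j1 j2; rewrite tensmxE !mxE.
rewrite (can_eq (@mxtens_indexK m n)) xpair_eqE.
by case: eqP; case: eqP => _ _; rewrite /= ?mulr0n ?mulr1n ?mulr0 ?mul0r.
Qed.

(** [m ^ 1] computes to [m] and not to [m * m ^ 0], so a recursion that also covers [k = 0] needs
    the cast along [expnS]. *)
Lemma ntensmx_succ m n (A : 'M[R]_(m, n)) k :
  ntensmx A k.+1
  = castmx (esym (expnS m k), esym (expnS n k)) (A *t ntensmx A k).
Proof.
case: k => [|k].
  rewrite ntensmx0 ntensmx1 -[1]/(1%:M) tens_mx_scalar scale1r castmx_comp.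
  by rewrite castmx_id.
by rewrite ntensmxSS castmx_id.
Qed.

Lemma ntensmx_mul m n p (A : 'M[R]_(m, n)) (B : 'M_(n, p)) k :
  ntensmx (A *m B) k = ntensmx A k *m ntensmx B k.
Proof.
elim: k => [|k IH]; first by rewrite !ntensmx0 mul1mx.
rewrite !ntensmx_succ IH -tensmx_mul.
by case: _ / (esym (expnS m k)); case: _ / (esym (expnS n k));
   case: _ / (esym (expnS p k)).
Qed.

Lemma ntensmx_scalar n (c : R) k :
  ntensmx (c%:M : 'M[R]_n) k = (c ^+ k)%:M.
Proof.
elim: k => [|k IH]; first by rewrite ntensmx0 expr0.
rewrite ntensmx_succ IH tens_scalar_scalar exprS.
by case: _ / (esym (expnS n k)).
Qed.

End Tensor.

Lemma adjmx_ntens (C : numClosedFieldType) m n (A : 'M[C]_(m, n)) k :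
  (ntensmx A k)^t* = ntensmx (A^t*) k.
Proof.
elim: k => [|k IH]; first by rewrite !ntensmx0 adjmx1.
rewrite !ntensmx_succ -IH -adjmx_tens.
by case: _ / (esym (expnS m k)); case: _ / (esym (expnS n k)).
Qed.

(** * Channels in Kraus form *)

Section Kraus.
Variables (R : realType) (a b : nat) (I : finType).
Implicit Type K : I -> 'M[R[i]]_(b, a).

Definition kraus K (X : 'M[R[i]]_a) : 'M[R[i]]_b :=
  \sum_i K i *m X *m (K i)^t*.

Lemma kraus_is_linear K : linear (kraus K).
Proof.
move=> c X Y; rewrite /kraus scaler_sumr -big_split; apply: eq_bigr => i _ /=.
by rewrite mulmxDr mulmxDl -scalemxAr -scalemxAl.
Qed.

HB.instance Definition _ K :=
  GRing.isLinear.Build R[i] 'M[R[i]]_a 'M[R[i]]_b _ (kraus K)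
    (kraus_is_linear K).

Lemma psdmx_conj n p (M : 'M[R[i]]_(n, p)) (X : 'M_p) :
  psdmx X -> psdmx (M *m X *m M^t*).
Proof.
move=> Xpsd v; have := Xpsd (M^t* *m v).
by rewrite adjmxM trmxCK !mulmxA.
Qed.

Lemma sum_tens_block k n (X : 'M[R[i]]_(k * n)) :
  X = \sum_(i < k) \sum_(j < k) delta_mx i j *t tens_block X i j.
Proof.
apply/matrixP => u v.
case: (mxtens_indexP u) => u1 u2; case: (mxtens_indexP v) => v1 v2.
rewrite summxE (bigD1 u1) //= summxE (bigD1 v1) //= tensmxE !mxE !eqxx mul1r.
rewrite !big1 ?addr0 // => [i /negPf ne | j /negPf ne].
  by rewrite summxE big1 // => j _; rewrite tensmxE mxE eq_sym ne mul0r.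
by rewrite tensmxE mxE (eq_sym v1) ne andbF mul0r.
Qed.

(** Expanding [X] in its blocks gives another Kraus sum, so complete positivity reduces to the
    positivity of conjugations. *)
Lemma ampliation_kraus K k (X : 'M[R[i]]_(k * a)) :
  ampliation (kraus K) X
  = \sum_i (1%:M *t K i) *m X *m (1%:M *t K i)^t*.
Proof.
rewrite /ampliation; under eq_bigr => x _.
  under eq_bigr => y _ do rewrite tensmx_sumr.
  rewrite exchange_big; over.
rewrite exchange_big; apply: eq_bigr => i _ /=.
rewrite [X in _ *m X *m _]sum_tens_block mulmx_sumr mulmx_suml.
apply: eq_bigr => x _; rewrite mulmx_sumr mulmx_suml.
apply: eq_bigr => y _.
by rewrite adjmx_tens adjmx1 !tensmx_mul mul1mx mulmx1.
Qed.

Lemma kraus_cptp K : \sum_i (K i)^t* *m K i = 1%:M -> cptp (kraus K).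
Proof.
move=> sumK1; split=> [k X Xpsd v | A].
  rewrite ampliation_kraus mulmx_sumr mulmx_suml summxE sumr_ge0 // => i _.
  exact: psdmx_conj.
rewrite /kraus raddf_sum /=.
(* Cyclicity of the trace brings the products [(K i)^t* *m K i] together. *)
under eq_bigr do rewrite mxtrace_mulC mulmxA.
by rewrite -raddf_sum -mulmx_suml sumK1 mul1mx.
Qed.

End Kraus.

(** * Recovery of a code whose noisy copies are equal or orthogonal *)

Section Recovery.
Variables (R : realType) (gT : finGroupType) (G : {group gT}) (a N : nat).
Variables (T : mx_representation R[i] G N) (J : 'M[R[i]]_(N, a)).
Hypothesis unitT : unitary_repr T.
Hypothesis isomJ : J^t* *m J = 1%:M.
Hypothesis orthJ :
  {in G, forall g, ~~ is_scalar_mx (T g) -> J^t* *m T g *m J = 0}.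

(** Conjugation by [T g] is trivial for these [g], so only the coset of the noise element modulo [K]
    has to be found. *)
Let K := [set g in G | is_scalar_mx (T g)]%SET.

Lemma repr_adj g : g \in G -> (T g)^t* = T g^-1%g.
Proof. by move=> Gg; rewrite repr_mxV // invmx_unitary // unitT. Qed.


(** The orthogonal projector onto the span of the ranges of all [T g *m J]. Elements of one coset of
    [K] give the same range, so each range is counted [#|K|] times. *)
Definition recovery_proj : 'M[R[i]]_N :=
  (#|K|%:R)^-1 *: \sum_(g in G) T g *m J *m (T g *m J)^t*.

Lemma card_scalar_neq0 : #|K|%:R != 0 :> R[i].
Proof.
rewrite pnatr_eq0 -lt0n; apply/card_gt0P; exists 1%g.
by rewrite inE group1 repr_mx1 scalar_mx_is_scalar.
Qed.

(** The overlap of two noisy codes depends only on [g^-1 * h], which is why [orthJ] can be stated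
    for single group elements. *)
Lemma repr_block g h : g \in G -> h \in G ->
  (T g *m J)^t* *m (T h *m J) = J^t* *m T (g^-1 * h)%g *m J.
Proof.
by move=> Gg Gh; rewrite adjmxM repr_adj // repr_mxM ?groupV // !mulmxA.
Qed.

Lemma recovery_proj_code h : h \in G -> recovery_proj *m (T h *m J) = T h *m J.
Proof.
move=> Gh; rewrite /recovery_proj -scalemxAl mulmx_suml.
(* Substituting [h * g^-1] for [g] turns the overlap into [J^t* *m T g *m J], which vanishes off
   [K]. *)
rewrite (reindex_inj (inj_comp (mulgI h) invg_inj)) /=.
rewrite (eq_bigl (mem G)); last by move=> g /=; rewrite groupMl ?groupV.
rewrite (bigID (mem K)) /= [X in _ + X]big1 ?addr0 => [|g /andP[Gg nKg]]; last first.
  rewrite -!mulmxA repr_block ?groupM ?groupV // invMg invgK -mulgA mulVg mulg1.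
  by rewrite orthJ ?mulmx0 //; move: nKg; rewrite !inE Gg.
rewrite (eq_bigr (fun=> T h *m J)) => [|g /andP[Gg]]; last first.
  rewrite inE Gg => /is_scalar_mxP[c Tg].
  rewrite -!mulmxA repr_block ?groupM ?groupV // invMg invgK -mulgA mulVg mulg1.
  rewrite Tg mul_mx_scalar -scalemxAl isomJ -scalemxAr mulmx1.
  (* The scalar is read as [T g] again and absorbed: [T (h * g^-1) *m T g = T h]. *)
  by rewrite -mul_scalar_mx -Tg mulmxA -repr_mxM ?groupM ?groupV // mulgKV.
rewrite sumr_const (_ : #|_| = #|K|).
  by rewrite -scalerMnr scalerMnl -mulr_natr mulVf ?scale1r ?card_scalar_neq0.
by apply: eq_card => g; rewrite [LHS]unfold_in /= !inE andbA andbb.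
Qed.

Lemma recovery_proj_idem : recovery_proj *m recovery_proj = recovery_proj.
Proof.
rewrite {2 3}/recovery_proj -scalemxAr mulmx_sumr; congr (_ *: _).
by apply: eq_bigr => g Gg; rewrite mulmxA recovery_proj_code.
Qed.

Lemma recovery_proj_adj : recovery_proj^t* = recovery_proj.
Proof.
rewrite /recovery_proj adjmxZ adjmx_sum geC0_conj ?invr_ge0 ?ler0n //; congr (_ *: _).
by apply: eq_bigr => g _; rewrite adjmxM trmxCK.
Qed.

(** A Kraus operator enters its channel twice, so each takes the square root of the weight in
    [recovery_proj]. *)
Let c : R[i] := (sqrtC #|K|%:R)^-1.

Let cc : c * c^* = (#|K|%:R)^-1.
Proof.
rewrite geC0_conj ?invr_ge0 ?sqrtC_ge0 ?ler0n //.
by rewrite -invfM -expr2 sqrtCK.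
Qed.

(* The summand [inr x] only completes the family to a trace preserving map; it
   acts outside the span of the noisy code spaces. *)
Definition recovery_kraus (i0 : 'I_a) (x : gT + 'I_N) : 'M[R[i]]_(a, N) :=
  match x with
  | inl g => if g \in G then c *: (T g *m J)^t* else 0
  | inr x => delta_mx i0 x *m (1%:M - recovery_proj)
  end.

(** The [inl] operators add up to [recovery_proj], the [inr] ones to the complementary projector
    [Q]. *)
Lemma recovery_kraus_complete i0 :
  \sum_x (recovery_kraus i0 x)^t* *m recovery_kraus i0 x = 1%:M.
Proof.
rewrite big_sumType /=.
have -> : \sum_g (recovery_kraus i0 (inl g))^t* *m recovery_kraus i0 (inl g)
    = recovery_proj.
  rewrite (bigID (mem G)) /= [X in _ + X]big1 ?addr0 => [|g /negPf->]; last first.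
    by rewrite mulmx0.
  rewrite /recovery_proj scaler_sumr; apply: eq_bigr => g -> /=.
  by rewrite adjmxZ trmxCK -scalemxAl -scalemxAr scalerA [c^* * c]mulrC cc.
set Q := 1%:M - recovery_proj.
have QQ : Q^t* *m Q = Q.
  rewrite /Q adjmxD adjmx1 -scaleN1r adjmxZ recovery_proj_adj rmorphN1.
  rewrite scaleN1r mulmxBl mul1mx mulmxBr mulmx1 recovery_proj_idem subrr.
  by rewrite subr0.
under eq_bigr do rewrite adjmxM adjmx_delta -mulmxA [X in _ *m X]mulmxA mul_delta_mx.
rewrite -mulmx_sumr -mulmx_suml -mx1_sum_delta mul1mx QQ.
by rewrite addrC subrK.
Qed.

(** The [inr] operators kill the range of [T h *m J], and the [inl] ones outside the coset of [h]
    vanish by orthogonality. Each of the [#|K|] others returns [rho] with weight [1 / #|K|], since a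
    scalar of modulus one cancels under conjugation. *)
Lemma recovery_correct i0 h rho : h \in G ->
  kraus (recovery_kraus i0) (T h *m (J *m rho *m J^t* ) *m (T h)^t*) = rho.
Proof.
move=> Gh; rewrite /kraus big_sumType /= [X in _ + X]big1 ?addr0 => [|x _]; last first.
  rewrite !mulmxA -2!(mulmxA (delta_mx _ _)) !mulmxBl mul1mx.
  by rewrite -(mulmxA recovery_proj) recovery_proj_code // subrr !(mulmx0, mul0mx).
rewrite (bigID (mem G)) /= [X in _ + X]big1 ?addr0 => [|g /negPf->]; last first.
  by rewrite !mul0mx.
transitivity (\sum_(g in G) c * c^* *: ((J^t* *m T (g^-1 * h)%g *m J) *m rho
    *m (J^t* *m T (g^-1 * h)%g *m J)^t*)).
  apply: eq_bigr => g Gg; rewrite Gg /= adjmxZ trmxCK.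
  rewrite -!repr_block // !adjmxM !trmxCK.
  by rewrite -!scalemxAl -!scalemxAr scalerA !mulmxA.
rewrite -scaler_sumr cc (reindex_inj (inj_comp (mulgI h) invg_inj)) /=.
rewrite (eq_bigl (mem G)); last by move=> g /=; rewrite groupMl ?groupV.
under eq_bigr do rewrite invMg invgK -mulgA mulVg mulg1.
rewrite (bigID (mem K)) /= [X in _ + X]big1 ?addr0 => [|g /andP[Gg nKg]]; last first.
  by rewrite orthJ ?mul0mx //; move: nKg; rewrite !inE Gg.
rewrite (eq_bigr (fun=> rho)) => [|g /andP[Gg]]; last first.
  rewrite inE Gg => /is_scalar_mxP[e Tg].
  rewrite {1}Tg mul_mx_scalar -!scalemxAl isomJ mul1mx.
  rewrite !adjmxM trmxCK !scalemxAr -mul_scalar_mx -Tg.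
  by rewrite !mulmxA mulmxKtV ?unitT // -mulmxA isomJ mulmx1.
rewrite sumr_const (_ : #|_| = #|K|).
  by rewrite -scalerMnr scalerMnl -mulr_natr mulVf ?scale1r ?card_scalar_neq0.
by apply: eq_card => g; rewrite [LHS]unfold_in /= !inE andbA andbb.
Qed.

End Recovery.

(** * Overlaps of vectors in tensor powers *)

Section Token.
Variable C : numClosedFieldType.

Lemma sandwich_cast m n m' n' (em : m = m') (en : n = n')
    (X Y : 'M[C]_(m, n)) (B : 'M_m) :
  (castmx (em, en) X)^t* *m castmx (em, em) B *m castmx (em, en) Y
  = castmx (en, en) (X^t* *m B *m Y).
Proof. by case: m' / em; case: n' / en. Qed.

Lemma sandwich_tens m n p q (v w : 'M[C]_(m, p)) (f g : 'M_(n, q))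
    (B : 'M_m) (E : 'M_n) :
  (v *t f)^t* *m (B *t E) *m (w *t g) = (v^t* *m B *m w) *t (f^t* *m E *m g).
Proof. by rewrite adjmx_tens !tensmx_mul. Qed.

(** [J] is the map sending [x] to [x] tensor [e], built one identity factor at a time. It serves
    both to attach the token to the data and to concatenate tokens. *)
Lemma token_embedding d r (e : 'cV[C]_(d ^ r)) m :
  exists J : 'M[C]_(d ^ (m + r), d ^ m), forall B : 'M_d,
    J^t* *m ntensmx B (m + r) *m J
    = (e^t* *m ntensmx B r *m e) 0 0 *: ntensmx B m.
Proof.
elim: m => [|m [J JE]].
  by exists e => B; rewrite ntensmx0 [LHS]mx11_scalar scalemx1.
exists (castmx (esym (expnS d (m + r)), esym (expnS d m)) (1%:M *t J)) => B.
rewrite -[(m.+1 + r)%N]/(m + r).+1 !ntensmx_succ sandwich_cast.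
rewrite sandwich_tens adjmx1 mul1mx mulmx1 JE tensmxZr.
by case: _ / (esym (expnS d m)).
Qed.

(* [sandwich_tens] with the column dimension [1 * 1] read as [1]. *)
Lemma sandwich_tens_cV m n (v w : 'cV[C]_m) (f g : 'cV_n) (B : 'M_m)
    (E : 'M_n) (al be : C) :
  v^t* *m B *m w = al%:M -> f^t* *m E *m g = be%:M ->
  (v *t f : 'cV_(m * n))^t* *m (B *t E) *m (w *t g : 'cV_(m * n))
  = (al * be)%:M.
Proof.
move=> vw fg; apply: (etrans (sandwich_tens v w f g B E)).
by rewrite vw fg; apply: tens_scalar_scalar.
Qed.

(* The vectors are [x = w^(x)s] and [f = \sum_(j <= s) v^(x)(s - j) (x) w^(x)j]. *)
Lemma symmetric_sum_vector d (v w : 'cV[C]_d) s :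
  exists f x : 'cV[C]_(d ^ s), forall (B : 'M_d) (al be : C),
    v^t* *m B *m v = al%:M -> w^t* *m B *m w = be%:M ->
    v^t* *m B *m w = 0 -> w^t* *m B *m v = 0 ->
    x^t* *m ntensmx B s *m x = (be ^+ s)%:M /\
    f^t* *m ntensmx B s *m f = (\sum_(j < s.+1) al ^+ (s - j) * be ^+ j)%:M.
Proof.
elim: s => [|s [f [x fx]]].
  exists 1%:M, 1%:M => B al be _ _ _ _.
  by rewrite ntensmx0 big_ord1 !expr0 mulr1 adjmx1 !mulmx1.
pose cast (y : 'cV[C]_(d * d ^ s)) : 'cV_(d ^ s.+1) :=
  castmx (esym (expnS d s), erefl 1%N) y.
(* Prefixing [v] to the old sum gives all terms but the last, which is the pure power of [w]. *)
exists (cast (v *t f + w *t x)), (cast (w *t x)) => B al be vv ww vw wv.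
have [xx ff] := fx B al be vv ww vw wv.
rewrite /cast !ntensmx_succ !sandwich_cast !castmx_id.
have {}vw : v^t* *m B *m w = 0%:M by rewrite vw raddf0.
have {}wv : w^t* *m B *m v = 0%:M by rewrite wv raddf0.
have fxE : f^t* *m ntensmx B s *m x = ((f^t* *m ntensmx B s *m x) 0 0)%:M.
  exact: mx11_scalar.
have xfE : x^t* *m ntensmx B s *m f = ((x^t* *m ntensmx B s *m f) 0 0)%:M.
  exact: mx11_scalar.
rewrite adjmxD !mulmxDl !mulmxDr (sandwich_tens_cV vv ff) (sandwich_tens_cV ww xx).
(* The cross terms contain the overlap of [v] with [B *m w], or of [w] with [B *m v], as a
   factor. *)
rewrite (sandwich_tens_cV vw fxE) (sandwich_tens_cV wv xfE) !mul0r raddf0.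
rewrite addr0 add0r -raddfD /=; split; first by rewrite exprS.
congr (_%:M); rewrite [RHS]big_ord_recr /= subnn expr0 mul1r exprS.
congr (_ + _); rewrite mulr_sumr; apply: eq_bigr => j _.
by rewrite subSn ?exprS ?mulrA // -ltnS.
Qed.

End Token.

(** * Vectors orthogonal to their image under a unitary of finite order *)

Lemma non_scalar_unitary_eigenvectors (C : numClosedFieldType) d (A : 'M[C]_d) :
  A \is unitarymx -> ~~ is_scalar_mx A ->
  exists v w : 'cV[C]_d, exists al be : C,
    [/\ v^t* *m v = 1%:M, w^t* *m w = 1%:M, v^t* *m w = 0 & w^t* *m v = 0] /\
    [/\ A *m v = al *: v, A *m w = be *: w & al != be].
Proof.
move=> Au An.
have /orthomx_spectralP Aspec : A \is normalmx.
  apply/normalmxP; rewrite (unitarymxP Au).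
  exact/esym/mulmx1C/unitarymxP.
set P := spectralmx A in Aspec; set sp := spectral_diag A in Aspec.
have Pu : P \is unitarymx by apply: spectral_unitarymx.
(* A diagonalisable matrix with a single eigenvalue is scalar, so two entries of the spectrum
   differ. *)
have [/existsP[i /existsP[j neq]]|/existsPn eq_sp] :=
  boolP [exists i, exists j, sp 0 i != sp 0 j]; last first.
  case/negP: An; apply/is_scalar_mxP.
  (* For [d = 0] there is no eigenvalue to pick, and the empty matrix equals the scalar matrix of
     [0]. *)
  have [i0 _|noI] := pickP 'I_d; last first.
    by exists 0; apply/matrixP => i; have := noI i.
  exists (sp 0 i0); rewrite [LHS]Aspec.
  have -> : diag_mx sp = (sp 0 i0)%:M.
    rewrite -diag_const_mx; congr diag_mx; apply/rowP => k; rewrite mxE.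
    by have /existsPn/(_ i0)/negPn/eqP := eq_sp k.
  by rewrite mul_mx_scalar -scalemxAl mulVmx ?scalemx1 ?unitarymx_unit.
have PP : P *m P^t* = 1%:M by apply/unitarymxP.
have eigen k : A *m (P^t* *m delta_mx k 0 : 'cV_d)
    = sp 0 k *: (P^t* *m delta_mx k 0).
  rewrite [in LHS]Aspec invmx_unitary // -!mulmxA (mulmxA P) PP mul1mx.
  rewrite scalemxAr; congr (_ *m _); apply/colP => l.
  by rewrite mul_diag_mx !mxE; case: eqP => [->|_] //; rewrite !mulr0.
have dot k l : (P^t* *m delta_mx k 0 : 'cV_d)^t* *m (P^t* *m delta_mx l 0)
    = (k == l)%:R%:M :> 'M_1.
  rewrite adjmxM trmxCK adjmx_delta mulmxA -(mulmxA _ P) PP mulmx1.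
  rewrite mul_delta_mx_cond; apply/matrixP => x y.
  by rewrite !ord1 mulrb; case: eqP; rewrite !mxE.
have neq_ij : i != j by apply: contraNneq neq => ->.
exists (P^t* *m delta_mx i 0), (P^t* *m delta_mx j 0), (sp 0 i), (sp 0 j).
by rewrite !eigen !dot !eqxx (eq_sym j) (negPf neq_ij) raddf0.
Qed.

(** With [n] factors the sum has [n.+1] terms, matching the exponent for which both eigenvalues are
    roots of unity. *)
Lemma orthogonal_orbit_vector (C : numClosedFieldType) d (A : 'M[C]_d) n :
  A \is unitarymx -> ~~ is_scalar_mx A -> A ^+ n.+1 = 1 ->
  exists f : 'cV[C]_(d ^ n),
    f^t* *m f = 1%:M /\ f^t* *m ntensmx A n *m f = 0.
Proof.
move=> Au An Apow.
have [v [w [al [be [[vv ww vw wv] [Av Aw neq]]]]]] :=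
  non_scalar_unitary_eigenvectors Au An.
have pow (u : 'cV[C]_d) c : u^t* *m u = 1%:M -> A *m u = c *: u -> c ^+ n.+1 = 1.
  move=> uu Au'.
  have powu k : A ^+ k *m u = c ^+ k *: u.
    elim: k => [|k IH]; first by rewrite !expr0 scale1r mul1mx.
    by rewrite exprSr -[_ * _]/(_ *m _) -mulmxA Au' -scalemxAr IH scalerA exprS.
  have := powu n.+1; rewrite Apow mul1mx => /(congr1 (fun y => (u^t* *m y) 0 0)).
  by rewrite -scalemxAr uu !mxE eqxx mulr1n mulr1.
have [f [x fx]] := symmetric_sum_vector v w n.
(* At [B = 1] the same formula gives the squared norm [n.+1], which fixes the normalisation of the
   witness. *)
have [_ ff] := fx 1%:M 1 1 ltac:(by rewrite mulmx1 vv)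
  ltac:(by rewrite mulmx1 ww) ltac:(by rewrite mulmx1 vw)
  ltac:(by rewrite mulmx1 wv).
have [_ fAf] : _ /\ f^t* *m ntensmx A n *m f = _ := fx A al be
  ltac:(by rewrite -mulmxA Av -scalemxAr vv scalemx1)
  ltac:(by rewrite -mulmxA Aw -scalemxAr ww scalemx1)
  ltac:(by rewrite -mulmxA Aw -scalemxAr vw scaler0)
  ltac:(by rewrite -mulmxA Av -scalemxAr wv scaler0).
exists ((sqrtC n.+1%:R)^-1 *: f); split; last first.
  rewrite -scalemxAr adjmxZ -!scalemxAl fAf.
  (* [al - be] times the overlap is [al ^+ n.+1 - be ^+ n.+1 = 0], and [al - be] is nonzero. *)
  have := subrXX al be n.+1; rewrite (pow v al) // (pow w be) // subrr => /esym/eqP.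
  by rewrite mulf_eq0 subr_eq0 (negPf neq) /= => /eqP ->; rewrite raddf0 !scaler0.
move: ff; rewrite ntensmx_scalar expr1n mulmx1 => ff.
rewrite adjmxZ -scalemxAl -scalemxAr scalerA ff scale_scalar_mx.
under eq_bigr do rewrite !expr1n mulr1.
rewrite sumr_const card_ord geC0_conj ?invr_ge0 ?sqrtC_ge0 ?ler0n //.
by rewrite -invfM -expr2 sqrtCK mulVf // pnatr_eq0.
Qed.

(** * Tensor powers of the representation and the reference token *)

Section TensorPower.
Variables (R : realType) (gT : finGroupType) (G : {group gT}) (d : nat).
Variable U : mx_representation R[i] G d.

Lemma ntensmx_repr k : mx_repr G (fun g => ntensmx (U g) k).
Proof.
split=> [|g h Gg Gh]; first by rewrite repr_mx1 ntensmx_scalar expr1n.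
by rewrite repr_mxM // ntensmx_mul.
Qed.

Definition ntens_repr k := MxRepresentation (ntensmx_repr k).

Hypothesis unitU : unitary_repr U.

Lemma ntens_repr_unitary k : unitary_repr (ntens_repr k).
Proof.
move=> g Gg; apply/unitarymxP; rewrite /= adjmx_ntens -ntensmx_mul.
by rewrite (unitarymxP (unitU Gg)) ntensmx_scalar expr1n.
Qed.

(** Used contrapositively: an element that is nonscalar on [k] qudits is nonscalar on one, hence
    detected by the token. *)
Lemma ntens_repr_scalar k g :
  is_scalar_mx (U g) -> is_scalar_mx (ntens_repr k g).
Proof.
by case/is_scalar_mxP=> c Ug; rewrite /= Ug ntensmx_scalar scalar_mx_is_scalar.
Qed.

(** Induction on the list: each nonscalar [g] contributes a new block of qudits, and since overlaps
    multiply, the orthogonality already obtained persists. *)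
Lemma token_exists (s : seq gT) : (0 < d)%N -> {subset s <= G} ->
  exists2 r, (0 < r)%N & exists e : 'cV[R[i]]_(d ^ r),
    e^t* *m e = 1%:M /\
    {in s, forall g, ~~ is_scalar_mx (U g) ->
       e^t* *m ntens_repr r g *m e = 0}.
Proof.
move=> d_gt0; elim: s => [_|g s IH sG].
  (* Starting from one qudit, and not from none, keeps [r] positive. *)
  exists 1%N => //; exists (delta_mx (Ordinal d_gt0) 0); split=> //.
  rewrite adjmx_delta mul_delta_mx; apply/matrixP => i j.
  by rewrite !ord1 !mxE.
have [|r r_gt0 [e [ee es]]] := IH; first by move=> h hs; rewrite sG // inE hs orbT.
have [/is_scalar_mxP Ug|nUg] := boolP (is_scalar_mx (U g)).
  exists r => //; exists e; split=> // h /[!inE] /orP[/eqP ->|]; last exact: es.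
  by case/negP; apply/is_scalar_mxP.
have Gg : g \in G by rewrite sG // mem_head.
have [|f [ff fUf]] := @orthogonal_orbit_vector _ _ (U g) #[g]%g.-1 (unitU Gg) nUg.
  have UX k : U (g ^+ k)%g = U g ^+ k.
    by elim: k => [|k Uk]; rewrite ?repr_mx1 // expgS exprS repr_mxM ?groupX ?Uk.
  by rewrite prednK ?order_gt0 // -UX expg_order repr_mx1.
have [J JE] := token_embedding e #[g]%g.-1.
(* [J *m f] is [f] tensor [e], so its overlap is the product of the two overlaps. *)
have JfE h : (J *m f)^t* *m ntens_repr (#[g]%g.-1 + r) h *m (J *m f)
    = (e^t* *m ntens_repr r h *m e) 0 0 *: (f^t* *m ntensmx (U h) #[g]%g.-1 *m f).
  by rewrite /= adjmxM mulmxA -2!(mulmxA (f^t* )) JE -scalemxAr -scalemxAl.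
exists (#[g]%g.-1 + r)%N; first by rewrite addn_gt0 r_gt0 orbT.
exists (J *m f); split.
  have := JfE 1%g; rewrite !repr_mx1 ntensmx_scalar expr1n !mulmx1.
  by rewrite ee ff mxE scale1r.
move=> h /[!inE] /orP[/eqP ->|hs] nUh; first by rewrite JfE fUf scaler0.
by rewrite JfE es // mxE scale0r.
Qed.

End TensorPower.

(** * Limit of the transmission rate *)

Lemma cvg_rate (R : realType) r :
  (0 < r)%N -> (fun m : nat => m%:R / (m + r)%:R : R) @ \oo --> (1 : R).
Proof.
case: r => // r _.
(* [harmonic n] is [1 / (n + 1)], hence the index [m + r] for the denominator [m + r.+1]. *)
have -> : (fun m : nat => m%:R / (m + r.+1)%:R : R)
    = (fun m => 1 - r.+1%:R * harmonic (m + r)%N).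
  apply/funext => m; rewrite /harmonic /= -addnS natrD.
  rewrite -[X in X - _](@divff _ (m%:R + r.+1%:R)) -?mulrBl ?addrK //.
  by rewrite -natrD pnatr_eq0 addnS.
suff : (fun m => 1 - r.+1%:R * harmonic (m + r)%N) @ \oo
    --> (1 - r.+1%:R * 0 : R) by rewrite mulr0 subr0.
apply: cvgB; first exact: cvg_cst.
apply: cvgM; first exact: cvg_cst.
by rewrite (cvg_shiftn r (harmonic : nat -> R)); apply: cvg_harmonic.
Qed.

Theorem mainTheorem3 (R : realType) (gT : finGroupType) (G : {group gT})
    (d : nat) (U : mx_representation R[i] G d) (hU : unitary_repr U) :
  exists r : nat,
    [/\ (0 < r)%N,
        (forall m : nat, (0 < m)%N ->
          exists (C : {linear 'M[R[i]]_(d ^ m) -> 'M[R[i]]_(d ^ (m + r))})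
                 (D : {linear 'M[R[i]]_(d ^ (m + r)) -> 'M[R[i]]_(d ^ m)}),
            [/\ cptp C, cptp D &
                forall p : gT -> R, is_distr G p ->
                  D \o collective_noise U p (N := m + r) \o C =1 id])
      & (fun m : nat => m%:R / (m + r)%:R : R) @ \oo --> (1 : R)].
Proof.
have [d0|d_gt0] := posnP d.
  (* For [d = 0] every space of at least one qudit is zero, so the empty Kraus family is a channel
     and all matrices are equal. *)
  exists 1%N; split=> [//|m m_gt0|]; last exact: cvg_rate.
  have no n : (0 < n)%N -> 'I_(d ^ n) -> False.
    by move=> n_gt0 [x]; rewrite d0 exp0n.
  have cptp0 n k : (0 < n)%N -> (0 < k)%N ->
      cptp (kraus (fun _ : void => 0 : 'M[R[i]]_(d ^ n, d ^ k))).
    move=> n_gt0 k_gt0; apply: kraus_cptp.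
    by apply/matrixP => i; case: (no k k_gt0 i).
  exists (kraus (fun _ : void => 0) : {linear _ -> _}).
  exists (kraus (fun _ : void => 0) : {linear _ -> _}).
  split; [apply: cptp0 => //; exact: ltn_addr|apply: cptp0 => //; exact: ltn_addr|].
  by move=> p _ X; apply/matrixP => i; case: (no m m_gt0 i).
have [|r r_gt0 [e [ee eU]]] := @token_exists _ _ _ _ U hU (enum G) d_gt0.
  by move=> g; rewrite mem_enum.
exists r; split=> [//|m m_gt0|]; last exact: cvg_rate.
have [J JE] := token_embedding e m.
have JJ : J^t* *m J = 1%:M.
  have := JE 1%:M; rewrite !ntensmx_scalar !expr1n !mulmx1 ee mxE.
  by rewrite scale1r.
have JU : {in G, forall g, ~~ is_scalar_mx (ntens_repr U (m + r) g) ->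
    J^t* *m ntens_repr U (m + r) g *m J = 0}.
  move=> g Gg nUg; have /= eg := eU g; rewrite JE eg ?mem_enum //; last first.
    by apply: contra nUg; apply: ntens_repr_scalar.
  by rewrite mxE scale0r.
(* The decoder sends whatever lies outside the noisy code spaces to this basis vector. *)
have i0 : 'I_(d ^ m) by exists 0%N; rewrite expn_gt0 d_gt0.
exists (kraus (fun _ : 'I_1 => J) : {linear _ -> _}).
exists (kraus (recovery_kraus (ntens_repr U (m + r)) J i0) : {linear _ -> _}).
split.
- by apply: kraus_cptp; rewrite big_ord1.
- by apply/kraus_cptp/recovery_kraus_complete => //; apply: ntens_repr_unitary.
move=> p [_ p1] X /=; rewrite /collective_noise linear_sum /=.
have -> : kraus (fun _ : 'I_1 => J) X = J *m X *m J^t* by rewrite /kraus big_ord1.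
(* Each noise term is decoded to [X] itself, so the sum is [X] times the total mass of [p]. *)
under eq_bigr => g Gg.
  rewrite linearZ /= (recovery_correct (T := ntens_repr U (m + r))) //; first over.
  exact: ntens_repr_unitary.
by rewrite -scaler_suml -rmorph_sum p1 scale1r.
Qed.
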